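(* For every positive integer $n$ and every $1\le k\le n$, we have $$|S_1(n,k-1)| = |\mathrm{CVP}(n,k)|.$$ In particular, summing over $k$, $|S_1(n)| = |\mathrm{CVP}(n)|$, where $S_1(n)=\bigcup_{k=0}^{n} S_1(n,k)$ and $\mathrm{CVP}(n)=\bigcup_{k=1}^{n}\mathrm{CVP}(n,k)$.
   Context: $[m]=\{1,2,\dots,m\}$. For $0\le k\le n$, $S_1(n,k)$ is the set of $k$-element subsets of $[n-1]$ the sum of whose elements is congruent to $1$ modulo $n$. A permutation $\sigma=\sigma_1\cdots\sigma_n$ of $[n]$ is cyclic if it consists of a single cycle. For $1\le k\le n$, $\mathrm{CVP}(n,k)$ is the set of cyclic permutations $\sigma$ of $[n]$ satisfying $\sigma_1>\sigma_2>\dots>\sigma_k<\sigma_{k+1}<\dots<\sigma_n$ (V-shaped permutations with minimum in position $k$). *)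

(* Defs.v *)
From mathcomp Require Import all_boot all_fingroup.

Set Implicit Arguments.
Unset Strict Implicit.
Unset Printing Implicit Defensive.

(* An element i : 'I_n of a subset stands for the integer i itself, so [n-1] is
   the set of nonzero ordinals. *)
Definition S1 (n k : nat) : {set {set 'I_n}} :=
  [set A : {set 'I_n} | [&& A \subset [set i : 'I_n | 0 < i],
                            #|A| == k
                          & \sum_(i in A) i == 1 %[mod n]]].

Definition S1_all (n : nat) : {set {set 'I_n}} := \bigcup_(0 <= k < n.+1) S1 n k.

(* In a permutation s : 'S_n both positions and values are shifted down by one:
   sigma_(i+1) = s i + 1. *)

(* porbits also contains the orbits of the fixed points. *)
Definition cyclic_perm (n : nat) (s : 'S_n) : bool := #|porbits s| == 1.

(* s i and s j with j = i + 1 are sigma_j and sigma_(j+1), whence a descent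
   exactly when j + 1 <= k. *)
Definition V_shaped (n k : nat) (s : 'S_n) : bool :=
  [forall i : 'I_n, forall j : 'I_n,
     (j == i.+1 :> nat) ==> (if j < k then s i > s j else s i < s j)].

Definition CVP (n k : nat) : {set 'S_n} :=
  [set s : 'S_n | cyclic_perm s && V_shaped k s].

Definition CVP_all (n : nat) : {set 'S_n} := \bigcup_(1 <= k < n.+1) CVP n k.

(* Main.v *)
Require Import Defs.
From mathcomp Require Import all_boot all_fingroup.
From mathcomp Require Import all_algebra all_field zify.

Set Implicit Arguments.
Unset Strict Implicit.
Unset Printing Implicit Defensive.

Import GRing.Theory.

(* Let T(k) be the number of k-subsets of Z/n with sum 1, and U(k) the number
   of cyclic permutations decreasing on the first k positions and increasing on
   the others. According to whether 0 belongs to the subset, resp. whether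
   sigma_k or sigma_(k+1) is the minimum, T(k) = S1(k) + S1(k-1) and
   U(k) = CVP(k+1) + CVP(k), so it suffices that T(k) = U(k). Both n T(k) and
   n U(k) equal the sum, over the k-subsets A of Z/n, of a weight f(A): if the
   group of translations fixing A is trivial then f(A) = 1, if it has order 2
   and k = 2 mod 4 then f(A) = 2, otherwise f(A) = 0.
   - For T, detect the sum by n-th roots of unity. The sum of w^(j sum(A)) over
     all k-subsets A is, up to a sign chi(j), the number of those fixed by
     translation by j (cyclic sieving); the remaining sum over the stabilizer
     of A is a character sum.
   - For U, a cyclic permutation with a base point is a bijection x from Z/n to
     the positions, x(i+1) = sigma(x(i)), and A = {i | x(i) < k} is its
     itinerary. The order of x(i) and x(j) is that of x(i+1) and x(j+1),
     reversed when i and j are in A, so x is the twisted lexicographic order on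
     the translates of A; ties between translates can be broken consistently
     only in the order-2 case above, and then in two ways. *)

(** * Permutations as rankings *)

Lemma card_ord_lt n k : k <= n -> #|[set v : 'I_n | v < k]| = k.
Proof.
move=> le_kn; rewrite cardsE -sum1_card.
rewrite (big_ord_narrow_cond (P := predT) (F := fun _ => 1) le_kn) /=.
by rewrite sum1_card card_ord.
Qed.

Lemma perm_rank n (x : 'S_n) i : x i = #|[set j | x j < x i]| :> nat.
Proof.
rewrite -{1}(card_ord_lt (ltnW (ltn_ord (x i)))).
rewrite -[LHS](card_preimset _ (@perm_inj _ x)); congr #|pred_of_set _|.
by apply/setP=> j; rewrite !inE.
Qed.

Lemma perm_order_inj n (x y : 'S_n) :
  (forall i j, (x i < x j) = (y i < y j)) -> x = y.
Proof.
move=> exy; apply/permP=> i; apply/val_inj.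
rewrite /= [LHS]perm_rank [RHS]perm_rank; congr #|pred_of_set _|.
by apply/setP=> j; rewrite !inE exy.
Qed.

Lemma exists_rank n (key : 'I_n -> nat) : injective key ->
  exists x : 'S_n, (forall i j, (x i < x j) = (key i < key j)) /\
                   (forall i, x i = #|[set j | key j < key i]| :> nat).
Proof.
move=> key_inj; pose rk i := #|[set j | key j < key i]|.
have rk_lt i j : key i < key j -> rk i < rk j.
  move=> lt_ij; apply: proper_card; apply/properP; split.
    by apply/subsetP=> l; rewrite !inE => /ltn_trans; apply.
  by exists i; rewrite inE ?ltnn.
have rkE i j : (rk i < rk j) = (key i < key j).
  case: (ltngtP (key i) (key j)) => [/rk_lt -> //|/rk_lt|eq_ij].
    by move=> /ltnW; rewrite leqNgt => /negbTE.
  by rewrite (key_inj _ _ eq_ij) ltnn.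
have rk_n i : rk i < n.
  rewrite -[X in _ < X]card_ord; apply: proper_card; apply/properP; split=> //.
    by apply/subsetP.
  by exists i; rewrite ?inE ?ltnn.
have rk_inj : injective (fun i => Ordinal (rk_n i)).
  move=> i j /(congr1 val) /= e; apply: key_inj.
  have := rkE i j; have := rkE j i; rewrite e ltnn.
  by case: (ltngtP (key i) (key j)).
exists (perm rk_inj); split=> [i j|i]; last by rewrite permE.
by rewrite !permE /= rkE.
Qed.

(** * Itineraries *)

Section Cyclic.
Local Open Scope ring_scope.

Variable m : nat.
Local Notation n := m.+1.
Local Notation z := (@inZp m).
Implicit Types (A : {set 'I_n}) (x y : 'S_n) (i j h : 'I_n).

Lemma inZpD a b : z (a + b) = z a + z b.
Proof. by apply/val_inj; rewrite /= modnDm. Qed.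

Lemma nat_of_ordD i j : (i + j : 'I_n) = ((i + j) %% n)%N :> nat.
Proof. by []. Qed.

Lemma inZpn : z n = 0.
Proof. by apply/val_inj; rewrite /= modnn. Qed.

Lemma inZp0 : z 0 = 0.
Proof. by apply/val_inj; rewrite /= mod0n. Qed.

Lemma inZpS a : z a.+1 = z a + z 1.
Proof. by rewrite -(addn1 a) inZpD. Qed.

Definition stab A := [set h | [forall i, (i + h \in A) == (i \in A)]].

Lemma stabP A h : reflect (forall i, (i + h \in A) = (i \in A)) (h \in stab A).
Proof. by rewrite inE; apply: (iffP forallP) => H i; apply/eqP. Qed.

Lemma stab0 A : 0 \in stab A.
Proof. by apply/stabP=> i; rewrite addr0. Qed.

Lemma stabD A h h' : h \in stab A -> h' \in stab A -> h + h' \in stab A.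
Proof. by move=> /stabP sh /stabP sh'; apply/stabP=> i; rewrite addrA sh' sh. Qed.

(** Here i is a time along the orbit and [x i] the position occupied then. For the permutation s
    taking [x i] to [x (i + z 1)], the condition says that s reverses order on positions below k and
    preserves it on the others. *)
Definition step_ok k x :=
  [forall i, forall j, (i != j) ==> ((x i < k) == (x j < k))%N ==>
     ((x i < x j)%N == (x (i + z 1)%R < x (j + z 1)%R) (+) (x i < k))%N].

Lemma step_okP k x :
  reflect (forall i j, i != j -> (x i < k)%N = (x j < k)%N ->
             (x i < x j)%N = ((x (i + z 1)%R < x (j + z 1)%R) (+) (x i < k))%N)
          (step_ok k x).
Proof.
apply: (iffP forallP) => [H i j nij ek | H i].
  by have /forallP/(_ j) := H i; rewrite nij ek eqxx => /eqP.
apply/forallP=> j; apply/implyP=> nij; apply/implyP=> /eqP ek.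
by apply/eqP; apply: H.
Qed.

Definition low k x := [set i | (x i < k)%N].

Lemma card_low k x : (k <= n)%N -> #|low k x| = k.
Proof.
move=> le_kn; rewrite -[RHS](card_ord_lt le_kn).
rewrite -[RHS](card_preimset _ (@perm_inj _ x)); congr #|pred_of_set _|.
by apply/setP=> j; rewrite !inE.
Qed.

(* An order disagreement between x and y at (i, j) propagates along the
   diagonal, so that [j - i] must be a period of the common low set. *)
Lemma compat_unique k x y :
  step_ok k x -> step_ok k y -> low k x = low k y ->
  (forall h, h \in stab (low k x) -> (x 0%R < x h)%N = (y 0%R < y h)%N) -> x = y.
Proof.
move=> /step_okP sx /step_okP sy eA hst; apply: perm_order_inj => i j.
have ek l : (y l < k)%N = (x l < k)%N.
  by have /setP/(_ l) := eA; rewrite !inE.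
have [-> | nij] := eqVneq i j; first by rewrite !ltnn.
have [//|dis] := eqVneq (x i < x j)%N (y i < y j)%N; exfalso.
have prop t : (x (i + z t)%R < k)%N = (x (j + z t)%R < k)%N /\
    (x (i + z t)%R < x (j + z t)%R)%N != (y (i + z t)%R < y (j + z t)%R)%N.
  have step l l' : l != l' -> (x l < x l')%N != (y l < y l')%N ->
      (x l < k)%N = (x l' < k)%N.
    move=> nll'; have [xk|xk] := ltnP (x l) k;
      have [xk'|xk'] := ltnP (x l') k => //;
      move: (ek l) (ek l'); rewrite !(ltnNge _ k) ?xk ?xk' /=; lia.
  elim: t => [|t [IHk IHt]].
    by rewrite inZp0 !addr0; split=> //; apply: step.
  have nt l : (i + l == j + l) = false by apply/negbTE; rewrite (inj_eq (addIr _)).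
  have dis' : (x (i + z t.+1)%R < x (j + z t.+1)%R)%N !=
              (y (i + z t.+1)%R < y (j + z t.+1)%R)%N.
    move: IHt; rewrite (sx _ _ (negbT (nt _)) IHk) (sy _ _ (negbT (nt _))) ?ek //.
    by rewrite (inZpS t) !addrA; do 3 case: (_ < _)%N.
  by split=> //; apply: step; rewrite ?nt.
have hS : j - i \in stab (low k x).
  apply/stabP=> l; rewrite !inE.
  have [] := prop (l - i : 'I_n); rewrite valZpK addrC subrK => -> _.
  by congr (x _ < k)%N; rewrite addrCA.
(* The time -i carries the disagreement to the pair (0, j - i), where [hst] excludes it. *)
have := hst _ hS; have [_] := prop (- i : 'I_n).
by rewrite valZpK subrr => /negP dis0 eq0; apply: dis0; rewrite eq0.
Qed.

(** The weight f(A) is [good k A * #|stab A|]: the only nontrivial period allowed is the half turn,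
    and only when k is 2 mod 4. *)
Definition good k A := [forall h in stab A,
  (h == 0) || ((2 * h == n)%N && (k %% 4 == 2)%N)].

Definition shift h : 'S_n := perm (@addIr _ h).

Lemma shiftE h x i : (shift h * x)%g i = x (i + h).
Proof. by rewrite permM permE. Qed.

Lemma low_shift k x h : h \in stab (low k x) -> low k (shift h * x)%g = low k x.
Proof.
by move=> /stabP hS; apply/setP=> i; rewrite -[RHS]hS !inE shiftE.
Qed.

Lemma step_ok_shift k x h : step_ok k x -> step_ok k (shift h * x)%g.
Proof.
move=> /step_okP sx; apply/step_okP=> i j nij; rewrite !shiftE => ek.
by rewrite sx ?(inj_eq (addIr _)) // -!(addrAC _ h).
Qed.

(** The time t is not reduced mod n. Steps from A reverse order, so the parity tells whether the
    order of two points differing by a period has been reversed after t steps. *)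
Definition cnt A t := (\sum_(u < t) (z u \in A))%N.

Lemma cntS A t : cnt A t.+1 = (cnt A t + (z t \in A))%N.
Proof. by rewrite /cnt big_ord_recr. Qed.

Lemma cntD A (h t : nat) :
  z h \in stab A -> cnt A (h + t) = (cnt A h + cnt A t)%N.
Proof.
move=> /stabP hS; elim: t => [|t IH]; first by rewrite addn0 /cnt big_ord0 addn0.
by rewrite addnS !cntS IH -addnA inZpD addrC hS.
Qed.

Lemma cntn A : cnt A n = #|A|.
Proof.
rewrite /cnt -sum1_card [RHS]big_mkcond /=; apply: eq_bigr => i _.
by rewrite valZpK; case: (i \in A).
Qed.

Lemma odd_cnt_mod A t : ~~ odd #|A| -> odd (cnt A (t %% n)) = odd (cnt A t).
Proof.
move=> evA; have cntDn u : odd (cnt A (u + n)) = odd (cnt A u).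
  elim: u => [|u IH]; first by rewrite add0n cntn (negbTE evA) /cnt big_ord0.
  by rewrite addSn !cntS !oddD IH inZpD inZpn addr0.
rewrite [in RHS](divn_eq t n) addnC; elim: (t %/ n)%N => [|q IH].
  by rewrite mul0n addn0.
by rewrite mulSn addnCA addnC cntDn.
Qed.

Lemma double_eq_card h : (2 * h == n)%N = (h + h == 0) && (h != 0).
Proof.
rewrite -!val_eqE /= mul2n -addnn; have := ltn_ord h.
move: (nat_of_ord h) => a lt_an.
have [hn|hn] := ltnP (a + a) n; first by rewrite modn_small //; lia.
rewrite -[in (_ %% _)%N](subnK hn) modnDr modn_small; lia.
Qed.

(** * Constraints on the periods of an itinerary *)

Section Necessity.

Variables (k : nat) (x : 'S_n).
Hypothesis sx : step_ok k x.
Local Notation A := (low k x).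
Let P h i := (x i < x (i + h)%R)%N.

Lemma period_step h i : h \in stab A -> h != 0 -> P h (i + z 1) = P h i (+) (i \in A).
Proof.
move=> /stabP hS h0; rewrite /P (step_okP _ _ sx i (i + h)).
- by rewrite inE addrAC -addbA addbb addbF.
- by rewrite -subr_eq0 opprD addNKr oppr_eq0.
- by have := hS i; rewrite !inE.
Qed.

Lemma period_cnt h t :
  h \in stab A -> h != 0 -> P h (z t) = P h 0 (+) odd (cnt A t).
Proof.
move=> hS h0; elim: t => [|t IH]; first by rewrite inZp0 /cnt big_ord0 addbF.
by rewrite inZpS period_step // IH cntS oddD addbA; case: (_ \in A).
Qed.

(** By [period_cnt], [P h] and [P h'] flip at the same times, and both are false at the time M when
    x is maximal. *)
Lemma period_indep h h' i : h \in stab A -> h != 0 -> h' \in stab A -> h' != 0 ->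
  P h i = P h' i.
Proof.
move=> hS h0 hS' h0'; pose M := (x^-1)%g ord_max.
have PM l : P l M = false.
  by rewrite /P /M permKV ltnNge -ltnS ltn_ord.
have := PM h; have := PM h'; rewrite -[M]valZpK -[i]valZpK !period_cnt //.
by case: (P h 0); case: (P h' 0); do 2 case: (odd _).
Qed.

(** Both [P h'] and [P h] may be replaced by [P (- h)] or each other; and [P (- h)] at i + h
    compares the same two values as [P h] at i, in the opposite order. *)
Lemma period_flip h h' i : h \in stab A -> h != 0 -> h' \in stab A -> h' != 0 ->
  P h' (i + h) = ~~ P h' i.
Proof.
move=> hS h0 hS' h0'; have nS : - h \in stab A.
  apply/stabP=> j; move/stabP: hS => hS.
  by rewrite -(hS (j - h)) subrK.
rewrite (period_indep _ hS' h0' nS) ?oppr_eq0 // (period_indep _ hS' h0' hS) //.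
rewrite /P addrK -leqNgt ltn_neqAle andb_idl // => _.
by rewrite (inj_eq val_inj) (inj_eq perm_inj) -subr_eq0 addrC addKr.
Qed.

Lemma step_ok_good : (k <= n)%N -> good k A.
Proof.
move=> le_kn; apply/forall_inP=> h hS; have [//|h0 /=] := eqVneq h 0.
(* If h + h were nonzero it would be a period too, and [P h] would flip once over h + h, yet twice
   over two successive translations by h. *)
have dh : (2 * h == n)%N.
  rewrite double_eq_card h0 andbT; apply/negPn/negP=> dh0.
  have := period_flip 0 (stabD hS hS) dh0 hS h0.
  by rewrite addrA !(period_flip _ hS h0 hS h0); case: (P _ _).
(* The flip over h is also governed by the visits to A, so their number over half a turn is odd; k
   is twice that number. *)
have od : odd (cnt A h).
  have := period_flip 0 hS h0 hS h0.
  rewrite add0r -{2}[h]valZpK period_cnt //.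
  by case: (P _ _); case: (odd _).
rewrite dh /=.
have : k = (cnt A h + cnt A h)%N.
  rewrite -[LHS](card_low x le_kn) -cntD ?valZpK //.
  by rewrite addnn -mul2n (eqP dh) cntn.
lia.
Qed.

End Necessity.

(** * Labelings with a prescribed itinerary *)

Section Existence.

Variables (k : nat) (A : {set 'I_n}).
Hypotheses (cardA : #|A| = k) (gA : good k A).

(* [itin t i] encodes the first t letters of the itinerary of i under a map
   that decreases on A and increases off A: numerical order is the twisted
   lexicographic order. *)
Fixpoint itin t i : nat :=
  if t is t'.+1 then
    if i \in A then (2 ^ t' - 1 - itin t' (i + z 1)%R)%N
    else (2 ^ t' + itin t' (i + z 1)%R)%N
  else 0%N.

Lemma itinS t i : itin t.+1 i =
  if i \in A then (2 ^ t - 1 - itin t (i + z 1)%R)%N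
  else (2 ^ t + itin t (i + z 1)%R)%N.
Proof. by []. Qed.

Lemma itin_lt t i : (itin t i < 2 ^ t)%N.
Proof.
elim: t i => [|t IH] i //=; have := IH (i + z 1); rewrite expnS.
by case: ifP => _; lia.
Qed.

(** A strict comparison is settled by a prefix, so further letters cannot change it. *)
Lemma itin_mono t i j : (itin t i < itin t j)%N -> (itin t.+1 i < itin t.+1 j)%N.
Proof.
elim: t i j => [|t IH] i j //.
have := IH (i + z 1) (j + z 1); have := IH (j + z 1) (i + z 1).
have := itin_lt t.+1 (i + z 1); have := itin_lt t.+1 (j + z 1).
have := itin_lt t (i + z 1); have := itin_lt t (j + z 1).
rewrite !(itinS t.+1) (itinS t i) (itinS t j) expnS.
by case: ifP; case: ifP; lia.
Qed.

Lemma itin_eq_letters t i j : itin t i = itin t j ->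
  forall u, (u < t)%N -> (i + z u \in A) = (j + z u \in A).
Proof.
elim: t i j => [|t IH] i j //= e u lt_ut.
have := itin_lt t (i + z 1); have := itin_lt t (j + z 1) => lj li.
have [eA e'] : (i \in A) = (j \in A) /\ itin t (i + z 1) = itin t (j + z 1).
  by move: e; case: ifP; case: ifP; lia.
case: u lt_ut => [|u] lt_ut; first by rewrite inZp0 !addr0.
by rewrite inZpS (addrC (z u)) !addrA; apply: IH.
Qed.

(** Words of n letters cover a whole turn, so equal codes mean equal translates of A. *)
Lemma itin_eq_stab i j : itin n i = itin n j -> j - i \in stab A.
Proof.
move=> e; apply/stabP=> l.
have := itin_eq_letters e (ltn_ord (l - i)).
by rewrite valZpK (addrC i) subrK => ->; congr (_ \in A); rewrite addrCA.
Qed.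

Lemma itin_stab t i h : h \in stab A -> itin t (i + h) = itin t i.
Proof.
move=> hS; elim: t i => [|t IH] i //=.
by rewrite addrAC IH (stabP _ _ hS).
Qed.

(* [B] breaks the ties: translates by a period h agree on [itin], and B changes
   between i and i + h since A meets half a turn in an odd number of points. *)
Let B i := odd (cnt A i).
Let key i := (2 * itin n i + B i)%N.

Lemma good_parity h : h \in stab A -> h != 0 ->
  [/\ ~~ odd k, odd (cnt A h) & h + h = 0].
Proof.
move=> hS h0; have /forall_inP/(_ h hS) := gA; rewrite (negbTE h0) /=.
move=> /andP[dh k2]; move: (dh); rewrite double_eq_card => /andP[/eqP hh _].
have : k = (cnt A h + cnt A h)%N.
  by rewrite -cardA -cntD ?valZpK // addnn -mul2n (eqP dh) cntn.
by split=> //; lia.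
Qed.

Lemma tie_flip i j : i != j -> itin n i = itin n j -> ~~ odd k /\ B j = ~~ B i.
Proof.
move=> nij /itin_eq_stab hS; have h0 : j - i != 0 by rewrite subr_eq0 eq_sym.
have [ek oh _] := good_parity hS h0; split=> //.
rewrite /B -{1}[j](subrK i) nat_of_ordD odd_cnt_mod ?cardA //.
by rewrite cntD ?valZpK // oddD oh.
Qed.

Lemma key_inj : injective key.
Proof.
move=> i j; rewrite /key => e.
have [//|nij] := eqVneq i j.
have e1 : itin n i = itin n j by lia.
have [_ e2] := tie_flip nij e1; move: e; rewrite e1 e2; case: (B i); lia.
Qed.

Lemma key_step i j : i != j -> (i \in A) = (j \in A) ->
  (key i < key j)%N = ((key (i + z 1)%R < key (j + z 1)%R) (+) (i \in A))%N.
Proof.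
move=> nij eA.
(* When the codes differ, [itin_mono] passes to length n + 1, where the common first letter can be
   stripped. *)
have lt_case i' j' : (i' \in A) = (j' \in A) -> (itin n i' < itin n j')%N ->
   [/\ (key i' < key j')%N, (key j' < key i')%N = false,
       (key (i' + z 1)%R < key (j' + z 1)%R)%N = (i' \notin A) &
       (key (j' + z 1)%R < key (i' + z 1)%R)%N = (i' \in A)].
  move=> eA' lt_ij; have := itin_mono lt_ij.
  rewrite !(itinS n) -eA'.
  have := itin_lt n (i' + z 1); have := itin_lt n (j' + z 1).
  rewrite /key; move: (itin n _) (itin n _) (2 ^ n)%N lt_ij => a b c.
  by case: (i' \in A) => /=; split; lia.
have [lt_ij|lt_ji|eq_ij] := ltngtP (itin n i) (itin n j).
- have [-> _ -> _] := lt_case _ _ eA lt_ij; by case: (i \in A).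
- have [_ -> _ ->] := lt_case _ _ (esym eA) lt_ji; by rewrite -eA; case: (i \in A).
(* On a tie B decides, and a step from i toggles B exactly when i is in A, even at the wrap-around,
   because k is even. *)
have [ek ej] := tie_flip nij eq_ij.
have hS := itin_eq_stab eq_ij.
have e1 : itin n (i + z 1) = itin n (j + z 1).
  by rewrite -(itin_stab n (i + z 1) hS); congr itin; rewrite addrAC (addrC i) subrK.
have nij1 : i + z 1 != j + z 1 by rewrite (inj_eq (addIr _)).
have [_ ej1] := tie_flip nij1 e1.
have ei1 : B (i + z 1) = B i (+) (i \in A).
  rewrite {1}/B -[X in X + _]valZpK -inZpS [nat_of_ord (z _)]/= odd_cnt_mod ?cardA //.
  by rewrite cntS oddD valZpK; case: (i \in A).
rewrite /key eq_ij e1 !ltn_add2l ej ej1 ei1.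
by case: (B i); case: (i \in A).
Qed.

Lemma exists_step_ok : exists x, step_ok k x /\ low k x = A.
Proof.
have [x [xlt xE]] := exists_rank key_inj.
(* Codes whose first letter is in A are the smaller ones, so the k points of A receive the ranks
   below k. *)
have AE i : (x i < k)%N = (i \in A).
  rewrite xE -cardA; have [iA|iA] := boolP (i \in A).
    apply: proper_card; apply/properP; split; last by exists i; rewrite ?inE ?ltnn.
    apply/subsetP=> j; rewrite inE => lt_ji; apply/negPn/negP=> jA; move: lt_ji.
    rewrite /key !(itinS m) iA (negbTE jA).
    have := itin_lt m (i + z 1); have := itin_lt m (j + z 1); lia.
  apply/negbTE; rewrite -leqNgt; apply: subset_leq_card; apply/subsetP=> j jA.
  rewrite inE /key !(itinS m) jA (negbTE iA).
  have := itin_lt m (i + z 1); have := itin_lt m (j + z 1); lia.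
exists x; split; last by apply/setP=> i; rewrite inE AE.
by apply/step_okP=> i j nij; rewrite !AE !xlt; apply: key_step.
Qed.

(** The labelings are the translates of one of them, x0, by the periods of A, and these translates
    are distinct. *)
Lemma card_step_ok_good :
  #|[set x | step_ok k x && (low k x == A)]| = #|stab A|.
Proof.
have [x0 [sx0 lx0]] := exists_step_ok.
have inj : {in stab A &, injective (fun h => (shift h * x0)%g)}.
  move=> h h' _ _ /(congr1 (fun s : 'S_n => s 0)).
  by rewrite !shiftE !add0r => /perm_inj.
rewrite -(card_in_imset inj); congr #|pred_of_set _|; apply/setP=> x; rewrite inE.
apply/andP/imsetP => [[sx /eqP lx]|[h hS ->]]; last first.
  by rewrite step_ok_shift // low_shift ?lx0.
(* Either x orders 0 and each period as x0 does, and x = x0, or it reverses the order of 0 and the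
   half turn, and x is the translate of x0 by the half turn. *)
have [/forall_inP agree|] :=
  boolP [forall h in stab A, (x 0%R < x h)%N == (x0 0%R < x0 h)%N].
  exists 0; first exact: stab0.
  have -> : (shift 0 * x0)%g = x0 by apply/permP=> i; rewrite shiftE addr0.
  by apply: (compat_unique sx sx0); rewrite lx ?lx0 // => h /agree/eqP.
rewrite negb_forall => /existsP[h]; rewrite negb_imply => /andP[hS dis].
have h0 : h != 0 by apply: contraNneq dis => ->; rewrite !ltnn.
have [_ _ hh] := good_parity hS h0.
exists h => //; apply: (compat_unique sx).
- exact: step_ok_shift.
- by rewrite low_shift ?lx0.
rewrite lx => h' hS'; have [->|h0'] := eqVneq h' 0; first by rewrite !ltnn.
have -> : h' = h.
  have /forall_inP gP := gA; apply/val_inj.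
  have := gP _ hS; have := gP _ hS'; rewrite (negbTE h0) (negbTE h0') /=; lia.
rewrite !shiftE hh add0r; move: dis.
have : x0 0 != x0 h :> nat by rewrite (inj_eq val_inj) (inj_eq perm_inj) eq_sym.
case: (ltngtP (x0 0) (x0 h)) => // _ _; by case: (x 0%R < x h)%N.
Qed.

End Existence.

Lemma card_step_ok k A : (k <= n)%N -> #|A| = k ->
  #|[set x | step_ok k x && (low k x == A)]| = (good k A * #|stab A|)%N.
Proof.
move=> le_kn cardA; have [gA|bA] := boolP (good k A).
  by rewrite mul1n card_step_ok_good.
rewrite mul0n; apply: eq_card0 => x; rewrite inE; apply/negP=> /andP[sx /eqP lx].
by move: bA; rewrite -lx step_ok_good.
Qed.

Lemma card_step_ok_sum k : (k <= n)%N ->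
  #|[set x | step_ok k x]| =
  (\sum_(A : {set 'I_n} | #|A| == k) good k A * #|stab A|)%N.
Proof.
move=> le_kn; rewrite -sum1_card.
rewrite (partition_big (low k) (fun A => #|A| == k)) /=; last first.
  by move=> x _; rewrite card_low.
apply: eq_bigr => A /eqP cardA; rewrite -card_step_ok // sum1dep_card.
by apply: eq_card => x; rewrite !inE.
Qed.

End Cyclic.

(** * Subsets with sum 1 *)

Section RootsOfUnity.
Local Open Scope ring_scope.

Lemma prod_1addZX (R : comNzRingType) (I : finType) (f : I -> R) k :
  (\prod_i (1 + f i *: 'X))`_k = \sum_(J : {set I} | #|J| == k) \prod_(i in J) f i.
Proof.
under eq_bigr => i _ do rewrite addrC.
rewrite bigA_distr coef_sum [RHS]big_mkcond /=; apply: eq_bigr => J _.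
rewrite -big_mkcond /= scaler_prod prodr_const coefZ coefXn eq_sym.
by case: eqP; rewrite ?mulr1 ?mulr0.
Qed.

(** Substituting -X in the factorization of X^d - 1 over the powers of w^-1 gives the product up to
    a constant c; evaluation at 0 yields c = -1. *)
Lemma prod_prim_root (F : fieldType) d (w : F) : d.-primitive_root w ->
  \prod_(0 <= i < d) (1 + w ^+ i *: 'X) = 1 - (- 'X) ^+ d :> {poly F}.
Proof.
move=> pw; have d_gt0 := prim_order_gt0 pw.
have w0 : w != 0 by rewrite -unitfE -(unitrX_pos _ d_gt0) (prim_expr_order pw) unitr1.
have pw' : d.-primitive_root w^-1.
  have -> : w^-1 = w ^+ d.-1.
    by apply: (mulfI w0); rewrite mulfV // -exprS prednK // (prim_expr_order pw).
  by rewrite prim_root_exp_coprime // -{2}(prednK d_gt0) coprimenS.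
pose c := \prod_(0 <= i < d) (- w ^+ i).
have prodE : \prod_(0 <= i < d) (1 + w ^+ i *: 'X) = c *: ((- 'X) ^+ d - 1).
  have -> : (- 'X) ^+ d - 1 = ('X^d - 1) \Po (- 'X) :> {poly F}.
    by rewrite rmorphB rmorphXn /= comp_polyX rmorph1.
  rewrite -(factor_Xn_sub_1 pw') rmorph_prod /= -scaler_prod.
  apply: eq_bigr => i _; rewrite rmorphB /= comp_polyX comp_polyC.
  have e : (w ^+ i)%:P * (w^-1 ^+ i)%:P = 1 :> {poly F}.
    by rewrite -polyCM exprVn mulfV ?expf_neq0.
  by rewrite -!mul_polyC polyCN mulNr mulrBr mulrN e opprB opprK.
have /(congr1 (horner^~ 0)) := prodE.
rewrite horner_prod big1 => [|i _]; last first.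
  by rewrite hornerD hornerC hornerZ hornerX mulr0 addr0.
rewrite hornerZ hornerD hornerN hornerC horner_exp hornerN hornerX oppr0 expr0n
  (gtn_eqF d_gt0) sub0r mulrN1 => /(congr1 -%R).
by rewrite opprK prodE => <-; rewrite scaleN1r opprB.
Qed.

Lemma prod_root_period (F : fieldType) d e (w : F) : d.-primitive_root w ->
  \prod_(0 <= i < e * d) (1 + w ^+ i *: 'X) = (1 - (- 'X) ^+ d) ^+ e :> {poly F}.
Proof.
move=> pw; rewrite -(prod_prim_root pw).
elim: e => [|e IH]; first by rewrite mul0n big_nil.
rewrite mulSn (big_cat_nat (n := d)) ?leq_addr //= exprS; congr (_ * _).
rewrite -{1}[d]add0n big_addn addKn -IH; apply: eq_bigr => i _.
by rewrite exprD (prim_expr_order pw) mulr1.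
Qed.

Variable m : nat.
Local Notation n := m.+1.
Local Notation z := (@inZp m).
Implicit Types (A : {set 'I_n}) (i j h : 'I_n).

(** * Sets of period e as subsets of the residues mod e *)

Section FixedSets.

Variables (e d : nat).
Hypothesis ned : n = (e * d)%N.

Let e_gt0 : (0 < e)%N. Proof. by case: (e) ned. Qed.

Definition lift_mod (C : {set 'I_e}) : {set 'I_n} :=
  [set i : 'I_n | Ordinal (ltn_pmod i e_gt0) \in C].
Definition proj_mod A : {set 'I_e} := [set r : 'I_e | z r \in A].

Lemma proj_lift_mod C : proj_mod (lift_mod C) = C.
Proof.
apply/setP=> r; rewrite !inE; congr (_ \in C); apply/val_inj => /=.
by rewrite modn_dvdm ?modn_small // ned dvdn_mulr.
Qed.

Lemma stabMn A t q : z t \in stab A -> z (t * q) \in stab A.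
Proof.
move=> tS; elim: q => [|q IH]; first by rewrite muln0 inZp0 stab0.
by rewrite mulnS inZpD stabD.
Qed.

Lemma stab_lift_mod C : z e \in stab (lift_mod C).
Proof.
apply/stabP=> i; rewrite !inE; congr (_ \in C); apply/val_inj => /=.
have en : (e %| n)%N by rewrite ned dvdn_mulr.
by rewrite modn_dvdm // -modnDmr modn_dvdm // modnn addn0.
Qed.

Lemma lift_proj_mod A : z e \in stab A -> lift_mod (proj_mod A) = A.
Proof.
move=> eS; apply/setP=> i; rewrite !inE /=.
have /stabP <- := stabMn (i %/ e)%N eS.
by rewrite -inZpD addnC mulnC -divn_eq valZpK.
Qed.

Lemma card_proj_mod A : z e \in stab A -> #|A| = (#|proj_mod A| * d)%N.
Proof.
move=> eS; have -> : #|proj_mod A| = cnt A e.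
  rewrite /cnt -sum1dep_card big_mkcond /=; apply: eq_bigr => r _.
  by case: (_ \in A).
rewrite -cntn ned; elim: (d) => [|q IH]; first by rewrite !muln0 /cnt big_ord0.
by rewrite !mulnS cntD // IH.
Qed.

End FixedSets.

(** * Cyclic sieving and the character sum over a stabilizer *)

Section Sieve.

Variables (w : algC) (k : nat).
Hypothesis pw : n.-primitive_root w.

(* The sign of the permutation induced by translation by [t] on a k-set that it
   fixes; junk when n does not divide [k * t]. *)
Definition chi (t : nat) : algC := (-1) ^+ (k.+1 * (k * t %/ n)).

(** j and gcd(j, n) generate the same subgroup of Z/n. *)
Lemma stab_gcd A j : (j \in stab A) = (z (gcdn j n) \in stab A).
Proof.
apply/idP/idP=> [jS | gS]; last first.
  rewrite -[j]valZpK; have /dvdnP[q ->] := dvdn_gcdl j n.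
  by rewrite mulnC stabMn.
have [->|j_gt0] := posnP j; first by rewrite gcd0n inZpn stab0.
have [u v uv _] := egcdnP n j_gt0.
have <- : z (j * u) = z (gcdn j n).
  by apply/val_inj; rewrite /= mulnC uv modnMDl.
by apply: stabMn; rewrite valZpK.
Qed.

Lemma card_stab_div A j : j \in stab A -> (n %/ gcdn j n %| #|A|)%N.
Proof.
have ne : n = (gcdn j n * (n %/ gcdn j n))%N by rewrite mulnC divnK ?dvdn_gcdr.
by rewrite stab_gcd => /(card_proj_mod ne) ->; rewrite dvdn_mull.
Qed.

Lemma stab_dvdn A j : j \in stab A -> #|A| = k -> (n %| k * j)%N.
Proof.
move=> /card_stab_div dk <-; have [q jE] := dvdnP (dvdn_gcdl j n).
rewrite jE mulnCA dvdn_mull // -{1}(divnK (dvdn_gcdr j n)).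
by rewrite dvdn_mul.
Qed.

(** On a k-set that it fixes, translation by j has c cycles of length n / gcd(j, n); the right-hand
    side is the product of their signs. *)
Lemma chi_sign j c : k = (c * (n %/ gcdn j n))%N ->
  chi j = ((-1) ^+ (n %/ gcdn j n).+1) ^+ c.
Proof.
have [i jE] := dvdnP (dvdn_gcdl j n); have [d nE] := dvdnP (dvdn_gcdr j n).
have g_gt0 : (0 < gcdn j n)%N by rewrite gcdn_gt0 orbT.
set g := gcdn j n in jE nE g_gt0 *.
have -> : (n %/ g)%N = d by rewrite nE mulnK.
move=> kE; rewrite /chi -exprM -signr_odd -[RHS]signr_odd.
congr (_ ^+ nat_of_bool _).
(* The two exponents have the same parity because i and d, being coprime, are not both even. *)
have co : odd i || odd d.
  have : (gcdn i d * g == g)%N by rewrite muln_gcdl -jE -nE.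
  rewrite -{2}(mul1n g) eqn_pmul2r // => /eqP co; apply/negPn/negP.
  rewrite negb_or -!dvdn2 => /andP[i2 d2].
  by have := dvdn_gcd 2 i d; rewrite i2 d2 co.
have -> : (k * j %/ n = c * i)%N.
  by rewrite kE jE nE mulnACA mulnK // -nE.
rewrite kE !oddM /= !oddM.
by move: co; case: (odd i); case: (odd d); case: (odd c).
Qed.

(* Translation by j permutes the residues mod n in [gcdn j n] cycles of equal
   length; both sides expand the product of [1 + w ^ (j i) X] over all i. *)
Lemma sieve j :
  \sum_(A : {set 'I_n} | #|A| == k) \prod_(i in A) (w ^+ j) ^+ i =
  \sum_(A : {set 'I_n} | (#|A| == k) && (j \in stab A)) chi j.
Proof.
pose e := gcdn j n; pose d := (n %/ e)%N.
have ne : n = (e * d)%N by rewrite mulnC divnK ?dvdn_gcdr.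
have pd : d.-primitive_root (w ^+ j) by exact: exp_prim_root.
rewrite -prod_1addZX -(big_mkord predT (fun i : nat => 1 + (w ^+ j) ^+ i *: 'X)).
rewrite [X in \prod_(0 <= _ < X) _]ne (prod_root_period _ pd).
have -> : (1 - (- 'X) ^+ d) ^+ e =
          \prod_(r < e) (1 + (-1) ^+ d.+1 *: 'X^d) :> {poly algC}.
  rewrite prodr_const card_ord (exprNn 'X); congr ((1 + _) ^+ _).
  rewrite -(signr_odd algC) scaler_sign -signr_odd mulr_sign /=.
  by case: (odd d); rewrite ?opprK.
under eq_bigr => r _ do rewrite addrC.
rewrite bigA_distr coef_sum.
rewrite (reindex_onto (proj_mod e) (lift_mod ne)) /=; last first.
  by move=> C _; rewrite proj_lift_mod.
rewrite [RHS]big_mkcond [LHS]big_mkcond /=; apply: eq_bigr => A _.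
rewrite stab_gcd -/e.
have [eS|neS] := boolP (z e \in stab A); last first.
  rewrite andbF; case: eqP => // AE.
  by move: neS; rewrite -AE stab_lift_mod.
rewrite andbT lift_proj_mod // eqxx -big_mkcond /= prodr_const exprZn coefZ.
rewrite -(exprM 'X) coefXn (card_proj_mod ne eS) mulnC eq_sym.
case: eqP => [kE|_]; rewrite ?mulr0 // mulr1.
by rewrite (@chi_sign j #|proj_mod e A|) // mulnC.
Qed.

(** As m is -1 mod n, the first factor is w^(-j), which tests for sum 1. For a k-set A, [twist] is a
    character of [stab A]. *)
Definition twist j : algC := w ^+ (j * m) * chi j.

Lemma twistD A h j : #|A| = k -> h \in stab A -> j \in stab A ->
  twist (h + j) = twist h * twist j.
Proof.
move=> cardA hS jS; have kh := stab_dvdn hS cardA; have kj := stab_dvdn jS cardA.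
rewrite /twist mulrACA -exprD -mulnDl; congr (_ * _).
  by apply/eqP; rewrite (eq_prim_root_expr pw) nat_of_ordD modnMml.
rewrite /chi -exprD -mulnDr -divnDl // -mulnDr nat_of_ordD.
set a := (h + j)%N; have ka : (n %| k * a)%N by rewrite mulnDr dvdn_add.
(* Reducing h + j mod n changes the exponent of [chi] by a multiple of k(k + 1), which is even. *)
have -> : (k * a %/ n = k * (a %% n) %/ n + k * (a %/ n))%N.
  by rewrite {1}(divn_eq a n) mulnDr mulnA divnMDl // addnC.
rewrite mulnDr exprD.
have -> : (-1) ^+ (k.+1 * (k * (a %/ n))) = 1 :> algC; last by rewrite mulr1.
by rewrite -signr_odd !oddM /=; case: (odd k).
Qed.

Lemma twist0 : twist 0 = 1.
Proof. by rewrite /twist /chi mul0n muln0 div0n muln0 !expr0 mulr1. Qed.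

Lemma twist_eq1 h : (n %| k * h)%N ->
  (twist h == 1) = (h == 0) || ((2 * h == n)%N && (k %% 4 == 2)%N).
Proof.
move=> kh; have [->|h0] := eqVneq h 0; first by rewrite twist0 eqxx.
have h_gt0 : (0 < h)%N by rewrite lt0n.
have lt_hn := ltn_ord h.
have [dh|ndh] /= := eqVneq (2 * h)%N n; last first.
  (* Squaring removes the sign [chi], so n divides 2h. *)
  apply/negbTE; apply: contraNneq ndh => /(congr1 (fun a => a ^+ 2)).
  rewrite expr1n exprMn /chi sqrr_sign mulr1 -exprM => /eqP.
  rewrite -(prim_order_dvd pw) mulnAC Gauss_dvdl ?coprimeSn // mulnC.
  by move=> /dvdnP[[|[|q]]] e; apply/eqP; move: e; rewrite ?mulSn; lia.
have wh : w ^+ h = -1.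
  apply/eqP; have : (w ^+ h) ^+ 2 == 1.
    by rewrite -exprM mulnC dh (prim_expr_order pw).
  by rewrite sqrf_eq1 -(prim_order_dvd pw) gtnNdvd.
have kE : k = (k * h %/ n * 2)%N.
  have [q e] := dvdnP kh; rewrite e mulnK //.
  by apply/eqP; rewrite -(eqn_pmul2r h_gt0) e -mulnA dh.
have om : odd m by lia.
rewrite /twist exprM wh /chi -exprD -signr_odd.
move: kE; set q := (_ %/ _)%N => kE.
(* With k = 2q and m odd, [twist h] is -1 to the power q + 1. *)
have -> : odd (m + k.+1 * q) = ~~ odd q.
  by rewrite oddD oddM om /= {1}kE oddM andbF.
have -> : (k %% 4 == 2)%N = odd q by lia.
case: (odd q); rewrite ?expr0 ?eqxx //= expr1.
by rewrite eq_sym -addr_eq0 (Num.Theory.pnatr_eq0 _ 2).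
Qed.

(** Orthogonality of characters: by [twist_eq1], A is good exactly when [twist] is trivial on
    [stab A]. *)
Lemma sum_twist A : #|A| = k ->
  \sum_(j in stab A) twist j = (good k A * #|stab A|)%:R.
Proof.
move=> cardA; have [gA|bA] := boolP (good k A).
  rewrite mul1n -sum1_card natr_sum; apply: eq_bigr => j jS; apply/eqP.
  by rewrite twist_eq1 ?(stab_dvdn jS) //; move/forall_inP: gA; apply.
rewrite mul0n; move: bA; rewrite negb_forall => /existsP[h].
rewrite negb_imply => /andP[hS]; rewrite -twist_eq1 ?(stab_dvdn hS) // => tw.
set S := \sum_(j in _) _.
have : twist h * S = S.
  rewrite /S big_distrr /= [RHS](reindex_inj (addrI h)) /=.
  apply: eq_big => [j | j jS]; last by rewrite (twistD cardA hS jS).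
  apply/idP/idP=> [jS|]; first exact: stabD.
  move: hS => /stabP hS /stabP jS; apply/stabP=> i.
  by rewrite -[in RHS](subrK h i) hS -jS addrA subrK.
move/eqP; rewrite -subr_eq0 -{2}[S]mul1r -mulrBl mulf_eq0 subr_eq0 (negbTE tw) /=.
by move/eqP.
Qed.

Lemma sum_root_expr t : \sum_(j < n) (w ^+ t) ^+ j = ((n %| t) * n)%:R.
Proof.
have [|ndt] := boolP (n %| t)%N.
  rewrite (prim_order_dvd pw) => /eqP ->.
  under eq_bigr => j _ do rewrite expr1n.
  by rewrite sumr_const card_ord mul1n.
rewrite mul0n; apply/eqP; move: ndt; rewrite (prim_order_dvd pw) => u1.
have := subrX1 (w ^+ t) n; rewrite -exprM mulnC exprM (prim_expr_order pw).
rewrite expr1n subrr => /esym/eqP; rewrite mulf_eq0 subr_eq0 (negbTE u1) /=.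
by [].
Qed.

Lemma card_sum1_twist :
  (n * #|[set A : {set 'I_n} | (#|A| == k) && (\sum_(i in A) i == 1 %[mod n])]|)%:R
  = \sum_(A : {set 'I_n} | #|A| == k) \sum_(j in stab A) twist j.
Proof.
transitivity (\sum_(A : {set 'I_n} | #|A| == k)
                 \sum_(j < n) w ^+ (j * m) * \prod_(i in A) (w ^+ j) ^+ i).
  rewrite mulnC -sum1dep_card big_distrl natr_sum /= big_mkcondr /=.
  apply: eq_bigr => A _; set S := (\sum_(i in A) i)%N.
  (* m stands for -1 mod n, which avoids a subtraction. *)
  have -> : (S == 1 %[mod n]) = (n %| m + S)%N.
    by rewrite -(eqn_modDl m) addn1 modnn.
  transitivity (\sum_(j < n) (w ^+ (m + S)) ^+ j).
    by rewrite sum_root_expr; case: (n %| _)%N.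
  apply: eq_bigr => j _.
  by rewrite prodrXr -/S -!exprM -exprD mulnDl mulnC (mulnC S).
rewrite exchange_big /=.
under eq_bigr => j _ do
  rewrite -big_distrr /= sieve big_mkcondr big_distrr.
rewrite exchange_big /=; apply: eq_bigr => A _; rewrite [RHS]big_mkcond /=.
by apply: eq_bigr => j _; rewrite /twist; case: ifP; rewrite ?mulr0.
Qed.

End Sieve.

End RootsOfUnity.

(** * Cyclic permutations *)

Definition sum1_sets (n k : nat) : {set {set 'I_n}} :=
  [set A : {set 'I_n} | (#|A| == k) && (\sum_(i in A) i == 1 %[mod n])].

(** Nothing is compared across the boundary between positions k - 1 and k (counted from 0); in
    [bimonotone_adjP] the exempted pair is j = k. *)
Definition bimonotone (n k : nat) (s : 'S_n) : bool :=
  [forall a : 'I_n, forall b : 'I_n, (a < b) ==> ((a < k) == (b < k)) ==>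
     ((s a < s b) == (k <= a))].

Definition cyclic_bimonotone (n k : nat) : {set 'S_n} :=
  [set s : 'S_n | cyclic_perm s && bimonotone k s].

Lemma bimonotoneP n k (s : 'S_n) :
  reflect (forall a b : 'I_n, a < b -> (a < k) = (b < k) -> (s a < s b) = (k <= a))
          (bimonotone k s).
Proof.
apply: (iffP forallP) => [H a b lt_ab ek | H a].
  by have /forallP/(_ b) := H a; rewrite lt_ab ek eqxx => /eqP.
apply/forallP=> b; apply/implyP=> lt_ab; apply/implyP=> /eqP ek.
by apply/eqP; apply: H.
Qed.

Lemma bimonotone_adjP n k (s : 'S_n) :
  reflect (forall i j : 'I_n, j = i.+1 :> nat -> j != k :> nat ->
             if j < k then s j < s i else s i < s j)
          (bimonotone k s).
Proof.
apply: (iffP (bimonotoneP k s)) => [H i j ij jk | H a b lt_ab].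
  have lt_ij : i < j by rewrite ij.
  have /(_ _)/esym e := H i j lt_ij; have ni : s i != s j :> nat.
    by rewrite (inj_eq val_inj) (inj_eq perm_inj) -val_eqE /= ij; lia.
  move: e ni jk; rewrite ij => e ni jk.
  by case: ifP => jk'; have := e ltac:(lia); lia.
have [c cE] : exists c, b = a + c.+1 :> nat.
  by exists (b - a).-1; lia.
elim: c b cE lt_ab => [|c IH] b bE lt_ab ek.
  move: ek; rewrite bE addn1 => ek.
  by have := H a b; rewrite bE addn1 => /(_ erefl ltac:(lia)); case: ifP; lia.
have ltb : a + c.+1 < n by have := ltn_ord b; lia.
move: ek; rewrite bE addnS => ek.
have := IH (Ordinal ltb) erefl ltac:(rewrite /=; lia) ltac:(rewrite /=; lia).
have := H (Ordinal ltb) b; rewrite bE addnS => /(_ erefl ltac:(lia)).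
by case: ifP; lia.
Qed.

Lemma V_shapedP n k (s : 'S_n) :
  reflect (forall i j : 'I_n, j = i.+1 :> nat ->
             if j < k then s j < s i else s i < s j)
          (V_shaped k s).
Proof.
apply: (iffP forallP) => [H i j /eqP ij | H i].
  by have /forallP/(_ j) := H i; rewrite ij; case: ifP.
by apply/forallP=> j; apply/implyP=> /eqP ij; have := H i j ij; case: ifP.
Qed.

(** Positions k - 1 and k form an ascent for k but a descent for l. *)
Lemma V_shaped_disjoint n k l (s : 'S_n) :
  0 < k -> k < l -> l <= n -> V_shaped k s -> V_shaped l s = false.
Proof.
move=> k_gt0 lt_kl le_ln /V_shapedP Vk; apply/negP=> /V_shapedP Vl.
have lt1 : k.-1 < n by lia.
have lt2 : k < n by lia.
have e : k = k.-1.+1 by lia.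
have := Vk (Ordinal lt1) (Ordinal lt2) e; have := Vl (Ordinal lt1) (Ordinal lt2) e.
rewrite /= ltnn lt_kl; lia.
Qed.

(** The free comparison across the boundary decides: an ascent puts the minimum at position k - 1, a
    descent at position k, counted from 0. *)
Lemma bimonotone_V_shaped n k (s : 'S_n) : 0 < k < n ->
  bimonotone k s = V_shaped k s || V_shaped k.+1 s.
Proof.
case/andP=> k_gt0 lt_kn; apply/bimonotone_adjP/orP.
  move=> H; have lt1 : k.-1 < n by lia.
  pose i0 := Ordinal lt1; pose j0 := Ordinal lt_kn.
  have n0 : s i0 != s j0 :> nat.
    by rewrite (inj_eq val_inj) (inj_eq perm_inj) -val_eqE /=; lia.
  have uniq_at (i j : 'I_n) : j = i.+1 :> nat -> j = k :> nat -> i = i0 /\ j = j0.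
    by move=> ij jk; split; apply: val_inj; rewrite /=; lia.
  have [lt_s|gt_s] := ltnP (s i0) (s j0); [left | right]; apply/V_shapedP=> i j ij.
    have [jk|jk] := eqVneq (j : nat) k; last exact: H.
    by have [-> ->] := uniq_at i j ij jk; rewrite /= ltnn.
  have [jk|jk] := eqVneq (j : nat) k.
    by have [-> ->] := uniq_at i j ij jk; rewrite /= ltnSn; lia.
  by have := H i j ij jk; rewrite (_ : (j < k.+1) = (j < k)) //; lia.
case=> /V_shapedP V i j ij jk; first exact: V.
by have := V i j ij; rewrite (_ : (j < k.+1) = (j < k)) //; lia.
Qed.

Lemma bimonotone0 n (s : 'S_n) : bimonotone 0 s = V_shaped 1 s.
Proof.
apply/bimonotone_adjP/V_shapedP => H i j ij; last by have := H i j ij; rewrite ij.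
by have := H i j ij; rewrite ij; apply.
Qed.

Lemma card_cyclic_bimonotone n k : 0 < k < n ->
  #|cyclic_bimonotone n k| = #|CVP n k| + #|CVP n k.+1|.
Proof.
move=> /[dup] kn /andP[k_gt0 lt_kn]; rewrite -cardsUI.
have -> : CVP n k :&: CVP n k.+1 = set0.
  apply/setP=> s; rewrite !inE; apply/negbTE/negP.
  by case/andP=> /andP[_ /V_shaped_disjoint ->] //; rewrite ?andbF.
rewrite cards0 addn0; apply: eq_card => s.
by rewrite !inE bimonotone_V_shaped // andb_orr.
Qed.

Lemma card_cyclic_bimonotone0 n : #|cyclic_bimonotone n 0| = #|CVP n 1|.
Proof. by apply: eq_card => s; rewrite !inE bimonotone0. Qed.

Section Positive.

Variable m : nat.
Local Notation n := m.+1.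
Local Notation z := (@inZp m).

Lemma S1E k : S1 n k = [set A in sum1_sets n k | ord0 \notin A].
Proof.
apply/setP=> A; rewrite !inE [RHS]andbC; congr (_ && _).
apply/subsetP/idP=> [sub | A0 i iA].
  by apply/negP=> /sub; rewrite inE.
rewrite inE lt0n; apply: contra A0 => /eqP i0.
by rewrite (_ : ord0 = i) //; apply/val_inj.
Qed.

Lemma card_sum1_setsS k : #|sum1_sets n k.+1| = #|S1 n k.+1| + #|S1 n k|.
Proof.
rewrite -(cardsID [set A : {set 'I_n} | ord0 \notin A]); congr (_ + _).
  by rewrite S1E; apply: eq_card => A; rewrite !inE.
have inj : {in S1 n k &, injective (fun A => ord0 |: A)}.
  move=> A B; rewrite !S1E !inE => /andP[_ A0] /andP[_ B0] e.
  by rewrite -(setU1K A0) e setU1K.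
rewrite -(card_in_imset inj); congr #|pred_of_set _|.
apply/setP=> A; rewrite !inE negbK.
apply/andP/imsetP => [[A0 /andP[cA sA]]|[B]].
  exists (A :\ ord0); last by rewrite setD1K.
  rewrite S1E !inE eqxx andbT; move: cA sA.
  rewrite (cardsD1 ord0) A0 add1n eqSS => ->.
  by rewrite (big_setD1 ord0).
rewrite S1E !inE => /andP[/andP[/eqP cB sB] B0] ->.
by rewrite setU11 cardsU1 B0 cB eqxx (big_setU1 _ B0).
Qed.

Lemma card_sum1_sets0 : #|sum1_sets n 0| = #|S1 n 0|.
Proof.
apply: eq_card => A; rewrite S1E !inE; have [/eqP|//] := eqVneq #|A| 0.
by rewrite cards_eq0 => /eqP ->; rewrite inE andbT.
Qed.

Lemma card_sum1_step_ok k : k <= n ->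
  n * #|sum1_sets n k| = #|[set x : 'S_n | step_ok k x]|.
Proof.
move=> le_kn; have [w pw] := C_prim_root_exists (ltn0Sn m).
rewrite card_step_ok_sum //.
apply/eqP; rewrite -(Num.Theory.eqr_nat algC); apply/eqP.
rewrite (card_sum1_twist k pw) natr_sum; apply: eq_bigr => A /eqP cardA.
by rewrite (sum_twist pw cardA).
Qed.

(** * Cyclic permutations with a base point *)

Definition conj_succ (x : 'S_n) : 'S_n := (x^-1 * shift (z 1) * x)%g.

Lemma conj_succE x i : conj_succ x (x i) = x (i + z 1)%R.
Proof. by rewrite /conj_succ !permM permK permE. Qed.

Lemma conj_succ_expg x t : (conj_succ x ^+ t)%g (x 0%R) = x (z t).
Proof.
elim: t => [|t IH]; first by rewrite expg0 perm1 inZp0.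
by rewrite expgSr permM IH conj_succE -inZpS.
Qed.

Lemma cyclic_permP (s : 'S_n) p : reflect (porbit s p = setT) (cyclic_perm s).
Proof.
apply: (iffP cards1P) => [[B sB] | full].
  have pB q : porbit s q = B by apply/set1P; rewrite -sB imset_f.
  by apply/setP=> q; rewrite inE pB -(pB q) porbit_id.
exists setT; apply/setP=> B; rewrite inE; apply/imsetP/eqP => [[q _ ->]|->].
  by apply/eqP; rewrite -full eq_porbit_mem full inE.
by exists p.
Qed.

Lemma conj_succ_cyclic x : cyclic_perm (conj_succ x).
Proof.
apply/(cyclic_permP _ (x 0%R)); apply/setP=> q; rewrite inE.
by rewrite -[q](permKV x) -[(x^-1)%g q]valZpK -conj_succ_expg mem_porbit.
Qed.

Lemma step_ok_bimonotone k x : step_ok k x = bimonotone k (conj_succ x).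
Proof.
apply/step_okP/bimonotoneP=> [H a b lt_ab | H i j nij ek].
  rewrite -[a](permKV x) -[b](permKV x) !conj_succE !permKV => ek.
  have nij : (x^-1)%g a != (x^-1)%g b.
    by rewrite (inj_eq perm_inj); apply: contraTneq lt_ab => ->; rewrite ltnn.
  have := H _ _ nij; rewrite !permKV ek lt_ab -ek => /(_ erefl).
  by rewrite (leqNgt k a); case: (a < k); case: (_ < _).
have nx : x i != x j :> nat by rewrite (inj_eq val_inj) (inj_eq perm_inj).
have nx1 : x (i + z 1)%R != x (j + z 1)%R :> nat.
  by rewrite (inj_eq val_inj) (inj_eq perm_inj) (inj_eq (addIr _)).
have [lt_ij|lt_ji|eq_ij] := ltngtP (x i) (x j); last by rewrite eq_ij eqxx in nx.
  by have := H _ _ lt_ij ek; rewrite !conj_succE (leqNgt k) => ->; case: (x i < k).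
have := H _ _ lt_ji (esym ek); rewrite !conj_succE (leqNgt k) -ek.
move: nx1; case: (ltngtP (x (i + z 1)%R) (x (j + z 1)%R)) => //= _ _;
  by case: (x i < k).
Qed.

(** The pair of [conj_succ x] and the base point [x 0] determines x, and every cyclic permutation s
    with base point p arises from the listing i -> s^i(p). *)
Lemma card_step_ok_cyclic k :
  #|[set x : 'S_n | step_ok k x]| = n * #|cyclic_bimonotone n k|.
Proof.
have inj : injective (fun x : 'S_n => (conj_succ x, x 0%R)).
  move=> x y [es e0]; apply/permP=> i.
  by rewrite -[i]valZpK -!conj_succ_expg es e0.
transitivity #|setX (cyclic_bimonotone n k) [set: 'I_n]|; last first.
  by rewrite cardsX cardsT card_ord mulnC.
rewrite -(card_imset _ inj); congr #|pred_of_set _|; apply/setP=> -[s p].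
rewrite !inE andbT; apply/imsetP/andP => [[x] | [cs bs]].
  by rewrite inE step_ok_bimonotone => bx [-> _]; rewrite conj_succ_cyclic.
have /(cyclic_permP _ p) full := cs.
have cn : #|porbit s p| = n by rewrite full cardsT card_ord.
have sn : (s ^+ n)%g p = p by have := iter_porbit s p; rewrite cn permX.
have inj_x : injective (fun i : 'I_n => (s ^+ i)%g p).
  move=> i j /=; rewrite !permX => e; apply/val_inj/eqP => /=.
  have := uniq_traject_porbit s p; rewrite cn => un.
  rewrite -(nth_uniq p _ _ un) ?size_traject ?ltn_ord //.
  by rewrite !nth_traject ?ltn_ord // e.
have s_mod t : (s ^+ (t %% n))%g p = (s ^+ t)%g p.
  rewrite [in RHS](divn_eq t n) expgD mulnC expgM permM.
  rewrite (_ : ((s ^+ n) ^+ _)%g p = p) //.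
  by rewrite permX; elim: (t %/ n) => //= u ->.
have sE : conj_succ (perm inj_x) = s.
  apply/permP=> q; rewrite -[q](permKV (perm inj_x)).
  move: ((perm inj_x)^-1%g q) => i.
  by rewrite conj_succE !permE /= modnDmr s_mod addn1 expgSr permM.
exists (perm inj_x); first by rewrite inE step_ok_bimonotone sE.
by rewrite sE permE expg0 perm1.
Qed.

(** Consecutive terms of the two sequences have equal sums T(k) = U(k), so equality propagates from
    k = 0. *)
Lemma card_S1_CVP k : k < n -> #|S1 n k| = #|CVP n k.+1|.
Proof.
have eqTU l : l <= n -> #|sum1_sets n l| = #|cyclic_bimonotone n l|.
  move=> le_ln; apply/eqP; rewrite -(eqn_pmul2l (ltn0Sn m)).
  by rewrite card_sum1_step_ok // card_step_ok_cyclic.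
elim: k => [|k IH] lt_kn.
  by rewrite -card_sum1_sets0 eqTU // card_cyclic_bimonotone0.
have := card_sum1_setsS k; rewrite eqTU 1?ltnW // card_cyclic_bimonotone //.
by rewrite IH 1?ltnW // addnC => /addIn.
Qed.

End Positive.

(** * Summation over k *)

Lemma card_bigcup_nat (T : finType) (F : nat -> {set T}) a b :
  (forall x i j, a <= i -> i < j -> j < b -> x \in F i -> x \notin F j) ->
  #|\bigcup_(a <= i < b) F i| = \sum_(a <= i < b) #|F i|.
Proof.
elim: b => [|b IH] dis; first by rewrite !big_geq ?cards0.
have [le_ab|lt_ba] := leqP a b; last by rewrite !big_geq ?cards0.
rewrite !big_nat_recr //= cardsU IH; last first.
  by move=> x i j ai ij jb; apply: dis => //; apply: ltnW.
rewrite (_ : _ :&: _ = set0) ?cards0 ?subn0 //; apply/setP=> x; rewrite !inE.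
apply/negbTE/negP=> /andP[xU xb].
have : exists2 i, a <= i < b & x \in F i.
  move: xU; rewrite big_nat; elim/big_rec: _ => [|i S ai IHS]; first by rewrite inE.
  by rewrite inE => /orP[xi|/IHS //]; exists i.
case=> i /andP[ai ib] xi; have := dis x i b ai ib (ltnSn b) xi; by rewrite xb.
Qed.

Theorem theorem3p1 (n : nat) (n_gt0 : 0 < n) :
  (forall k : nat, 1 <= k <= n -> #|S1 n (k - 1)| = #|CVP n k|)
  /\ #|S1_all n| = #|CVP_all n|.
Proof.
case: n n_gt0 => // m _.
have eqS k : 1 <= k <= m.+1 -> #|S1 m.+1 (k - 1)| = #|CVP m.+1 k|.
  by case: k => // k /= le_k; rewrite subn1 card_S1_CVP.
split=> //; rewrite /S1_all /CVP_all !card_bigcup_nat.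
(* The subset union has one more index, k = m + 1, which contributes nothing as there are only m
   nonzero residues. *)
- rewrite big_nat_recr //= [X in _ + X]eq_card0 ?addn0 => [|A].
    rewrite [RHS]big_add1 /=; apply: eq_big_nat => k /= lt_k.
    by rewrite card_S1_CVP.
  rewrite !inE; apply/negbTE/negP=> /and3P[sA /eqP cA _].
  have := subset_leq_card sA; rewrite cA leqNgt => /negP; apply.
  rewrite -[X in _ < X]card_ord; apply: proper_card.
  by apply/properP; split; [apply/subsetP | exists ord0; rewrite ?inE].
- move=> s k l k_gt0 lt_kl lt_l; rewrite !inE => /andP[_ /V_shaped_disjoint ->] //.
  by rewrite andbF.
move=> A i j _ lt_ij _; rewrite !inE => /and3P[_ /eqP -> _].
by rewrite (ltn_eqF lt_ij) andbF.
Qed.
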